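(* Let $R$ be an integral domain and let $\ast=\tilde{\ast}$ be a star operation on $R$ that is spectral and of finite type. If $R$ is Clifford $\ast$-regular, then $R$ has the $\ast$-finite character.
   Context: $R$ is an integral domain with field of fractions $K$. An ideal of $R$ means a nonzero fractional ideal (an integral ideal if contained in $R$); prime ideals are integral and nonzero. $\mathcal F(R)$ is the set of ideals, and $(J:I)=\{x\in K: xI\subseteq J\}$. A star operation on $R$ is a map $\mathcal F(R)\to\mathcal F(R)$, $I\mapsto I^\ast$, such that for all $0\ne a\in K$ and $I,J\in\mathcal F(R)$: $R^\ast=R$ and $(aI)^\ast=aI^\ast$; $I\subseteq I^\ast$, and $I\subseteq J$ implies $I^\ast\subseteq J^\ast$; $I^{\ast\ast}=I^\ast$. It is of finite type if $I^\ast=\bigcup\{J^\ast: J\subseteq I,\ J \text{ a finitely generated ideal}\}$ for all $I$. $I$ is a $\ast$-ideal if $I=I^\ast$; a $\ast$-maximal ideal is a maximal element of the set of proper integral $\ast$-ideals; $\ast\text{-Max}(R)$ is the set of $\ast$-maximal ideals. For $\ast$ of finite type, $\tilde{\ast}$ is the star operation $I\mapsto\bigcap_{M\in\ast\text{-Max}(R)}IR_M$; one has $\ast=\tilde\ast$ exactly when $\ast$ is spectral (i.e. $I^\ast=\bigcap_{P\in\mathcal G}IR_P$ for some family $\mathcal G$ of pairwise incomparable primes with $R=\bigcap_{P\in\mathcal G}R_P$) and of finite type. $R$ is Clifford $\ast$-regular if for every ideal $I$ of $R$ there is an ideal $J$ of $R$ with $I^\ast=(I^2J)^\ast$. $R$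 has the $\ast$-finite character if each nonzero element of $R$ is contained in at most finitely many $\ast$-maximal ideals. *)

(* Defs.v *)
From mathcomp Require Import all_boot all_order all_algebra.
From mathcomp Require Import boolp classical_sets cardinality.

Set Implicit Arguments.
Unset Strict Implicit.
Unset Printing Implicit Defensive.

Import GRing.Theory.
Local Open Scope classical_set_scope.
Local Open Scope ring_scope.

Section Ideals.
Variable R : idomainType.
Local Notation K := {fraction R}.
Implicit Types (I J M P : set K) (G : set (set K)).

(* Ideals, including the integral ones, are subsets of K, so that R itself is
   represented by its image in K. *)
Definition base_ring : set K := range (@tofrac R).

(* The last clause is the existence of a common denominator. *)
Definition fractional_ideal I : Prop :=
  [/\ I 0,
      (forall x y : K, I x -> I y -> I (x + y)),
      (forall (r : R) (x : K), I x -> I (tofrac r * x)),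
      (exists2 x : K, I x & x != 0)
    & (exists2 d : R, d != 0 & forall x : K, I x -> base_ring (tofrac d * x))].

Definition integral_ideal I : Prop := fractional_ideal I /\ I `<=` base_ring.

Definition prime_ideal P : Prop :=
  [/\ integral_ideal P,
      P <> base_ring
    & forall a b : R, P (tofrac (a * b)) -> P (tofrac a) \/ P (tofrac b)].

Definition ideal_scale (a : K) I : set K := [set a * x | x in I].

(* Applied to ideals, but also to I and R_P, giving the extension I R_P. *)
Definition ideal_mul I J : set K :=
  [set x | exists (n : nat) (u v : 'I_n -> K),
     (forall i, I (u i) /\ J (v i)) /\ x = \sum_(i < n) u i * v i].

Definition ideal_span (gs : seq K) : set K :=
  [set x | exists c : 'I_(size gs) -> R,
     x = \sum_(i < size gs) tofrac (c i) * gs`_i].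

Definition fg_ideal J : Prop :=
  fractional_ideal J /\ exists gs : seq K, J = ideal_span gs.

Definition localization P : set K :=
  [set x | exists a s : R, ~ P (tofrac s) /\ x = tofrac a / tofrac s].

(* A star operation is a total function on subsets of K, but it is only
   constrained, and only ever evaluated, on fractional ideals. *)
Record star_operation (star : set K -> set K) : Prop := StarOperation {
  star_ideal : forall I, fractional_ideal I -> fractional_ideal (star I);
  star_base_ring : star base_ring = base_ring;
  star_scale : forall (a : K) I, a != 0 -> fractional_ideal I ->
    star (ideal_scale a I) = ideal_scale a (star I);
  star_extensive : forall I, fractional_ideal I -> I `<=` star I;
  star_monotone : forall I J, fractional_ideal I -> fractional_ideal J ->
    I `<=` J -> star I `<=` star J;
  star_idempotent : forall I, fractional_ideal I -> star (star I) = star I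
}.

Variable star : set K -> set K.

Definition star_finite_type : Prop :=
  forall I, fractional_ideal I ->
    star I = \bigcup_(J in [set J | fg_ideal J /\ J `<=` I]) star J.

Definition proper_integral_star_ideal I : Prop :=
  [/\ integral_ideal I, I <> base_ring & star I = I].

Definition star_max : set (set K) :=
  [set M | proper_integral_star_ideal M /\
     forall I, proper_integral_star_ideal I -> M `<=` I -> I = M].

Definition star_tilde I : set K :=
  \bigcap_(M in star_max) ideal_mul I (localization M).

Definition star_spectral : Prop :=
  exists G : set (set K),
    [/\ (forall P, G P -> prime_ideal P),
        (forall P Q, G P -> G Q -> P `<=` Q -> P = Q),
        base_ring = \bigcap_(P in G) localization P
      & forall I, fractional_ideal I ->
          star I = \bigcap_(P in G) ideal_mul I (localization P)].

Definition clifford_star_regular : Prop :=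
  forall I, fractional_ideal I ->
    exists2 J, fractional_ideal J &
      star I = star (ideal_mul (ideal_mul I I) J).

Definition star_finite_character : Prop :=
  forall r : R, r != 0 -> finite_set [set M | star_max M /\ M (tofrac r)].

End Ideals.

(* Main.v *)
Require Import Defs.
From mathcomp Require Import all_boot all_order all_algebra.
From mathcomp Require Import boolp classical_sets cardinality.
From mathcomp Require Import perm ring.

(** Write [*] as the intersection of the localizations at a family [G] of
    primes.  If [r <> 0] lies in infinitely many [*]-maximal ideals, there are
    finitely generated ideals [I_0, I_1, ...] containing [r], each contained in
    some prime of [G], no prime of [G] containing two of them.  By Clifford
    regularity and the determinant trick, [Q_n = (I_n^* : I_n^2)] satisfies
    [1 \in (I_n Q_n)_P] for all [P] in [G].  Apply Clifford regularity to
    [J = R + \sum_n Q_n], which at [P] is [Q_n] when [P] contains [I_n] and [R]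
    when [P] contains no [I_n]: if [J^* = (J^2 X)^*], then [1 \in (J X)^*].  By
    finite type only [Q_0, ..., Q_(n-1)] are needed for this, and these are
    trivial at a prime [P] containing [I_n].  So [1 \in X_P], hence
    [Q_n^2 \subset (Q_n)_P], and
    [1 \in ((I_n Q_n)^2)_P \subset (I_n^2 Q_n)_P \subset (I_n)_P \subset P R_P]. *)

Set Implicit Arguments.
Unset Strict Implicit.
Unset Printing Implicit Defensive.

Import GRing.Theory.
Local Open Scope classical_set_scope.
Local Open Scope ring_scope.

(** * Submodules of the fraction field, their products and finite spans *)

Section Submodules.
Variable R : idomainType.
Local Notation K := {fraction R}.
Local Notation iota := (@tofrac R).
Implicit Types (I J M P S T X : set K) (r s : R) (x y : K).

(** The nonzero element and the common denominator of [fractional_ideal] are dropped: localizations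
    and preimages under multiplication may lack a common denominator. *)
Definition submodule I : Prop :=
  [/\ I 0, (forall x y, I x -> I y -> I (x + y))
    & (forall r x, I x -> I (iota r * x))].

Lemma fractional_submodule I : fractional_ideal I -> submodule I.
Proof. by case. Qed.

Lemma submodule_sum I n (f : 'I_n -> K) :
  submodule I -> (forall i, I (f i)) -> I (\sum_(i < n) f i).
Proof. by case=> I0 ID _ If; elim/big_ind: _. Qed.

Lemma base_ringP r : base_ring (iota r).
Proof. by exists r. Qed.

Lemma base_ring_fractional : fractional_ideal (@base_ring R).
Proof.
split.
- by exists 0 => //; rewrite tofrac0.
- by move=> _ _ [a _ <-] [b _ <-]; exists (a + b) => //; rewrite tofracD.
- by move=> a _ [b _ <-]; exists (a * b) => //; rewrite tofracM.
- by exists 1; [exists 1 => //; rewrite tofrac1|exact: oner_neq0].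
- by exists 1; [exact: oner_neq0|move=> x; rewrite tofrac1 mul1r].
Qed.

Lemma mem_ideal_mul I J x y : I x -> J y -> ideal_mul I J (x * y).
Proof.
move=> Ix Jy; exists 1%N, (fun=> x), (fun=> y); split=> //.
by rewrite big_ord1.
Qed.

Lemma ideal_mul_sub I J T : submodule T ->
  (forall x y, I x -> J y -> T (x * y)) -> ideal_mul I J `<=` T.
Proof.
move=> sT IJT _ [n [u [v [uv ->]]]]; apply: submodule_sum => // i.
by case: (uv i) => ? ?; apply: IJT.
Qed.

(** With [ideal_mul_sub], this reduces a claim that is linear in one factor to generators of that
    factor. *)
Lemma preim_mull_submodule I x : submodule I -> submodule [set y | I (x * y)].
Proof.
move=> [I0 ID IZ]; split => /=; first by rewrite mulr0.
- by move=> y z ? ?; rewrite mulrDr; apply: ID.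
- by move=> r y ?; rewrite mulrCA; apply: IZ.
Qed.

Lemma preim_mulr_submodule I y : submodule I -> submodule [set x | I (x * y)].
Proof.
move=> sI; have -> : [set x | I (x * y)] = [set x | I (y * x)].
  by apply/seteqP; split=> x /=; rewrite mulrC.
exact: preim_mull_submodule.
Qed.

Lemma ideal_mul_submodule I J : submodule I -> submodule (ideal_mul I J).
Proof.
move=> [I0 ID IZ]; split.
- exists 0%N, (fun=> 0), (fun=> 0); split; first by case.
  by rewrite big_ord0.
- move=> _ _ [n [u [v [uv ->]]]] [m [u' [v' [uv' ->]]]].
  exists (n + m)%N.
  exists (fun i => match split i with inl j => u j | inr j => u' j end).
  exists (fun i => match split i with inl j => v j | inr j => v' j end).
  split; first by move=> i; case: (split i).
  rewrite big_split_ord; congr (_ + _); apply: eq_bigr => i _.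
    by rewrite -[lshift _ _]/(unsplit (inl i)) unsplitK.
  by rewrite -[rshift _ _]/(unsplit (inr i)) unsplitK.
- move=> r _ [n [u [v [uv ->]]]]; exists n, (fun i => iota r * u i), v.
  split; first by move=> i; case: (uv i) => ? ?; split=> //; apply: IZ.
  by rewrite mulr_sumr; apply: eq_bigr => i _; rewrite mulrA.
Qed.

Lemma ideal_mul3_sub I J X T : submodule T ->
  (forall x y z, I x -> J y -> X z -> T (x * y * z)) ->
  ideal_mul (ideal_mul I J) X `<=` T.
Proof.
move=> sT IJXT; apply: ideal_mul_sub => // x z IJx Xz; move: x IJx.
apply: (ideal_mul_sub (preim_mulr_submodule z sT)) => x y Ix Jy.
exact: IJXT.
Qed.

Lemma ideal_mul_fractional I J :
  fractional_ideal I -> fractional_ideal J -> fractional_ideal (ideal_mul I J).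
Proof.
move=> fI fJ.
have [M0 MD MZ] := ideal_mul_submodule J (fractional_submodule fI).
case: fI => _ _ _ [x Ix x0] [d d0 dI]; case: fJ => _ _ _ [y Jy y0] [e e0 eJ].
split=> //.
- by exists (x * y); [exact: mem_ideal_mul|rewrite mulf_neq0].
- exists (d * e); first by rewrite mulf_neq0.
  have sR := fractional_submodule base_ring_fractional.
  apply: ideal_mul_sub; first exact: preim_mull_submodule.
  move=> u v /dI[a _ ha] /eJ[b _ hb] /=; exists (a * b) => //.
  by rewrite !tofracM ha hb mulrACA.
Qed.

Lemma ideal_span_sub (gs : seq K) T : submodule T ->
  (forall x, x \in gs -> T x) -> ideal_span gs `<=` T.
Proof.
move=> sT gT _ [c ->]; apply: submodule_sum => // i.
by case: sT => _ _; apply; apply: gT; apply: mem_nth.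
Qed.

Lemma mem_ideal_span (gs : seq K) x : x \in gs -> ideal_span gs x.
Proof.
move=> xgs; have lt : (index x gs < size gs)%N by rewrite index_mem.
exists (fun i => if i == Ordinal lt then 1 else 0).
rewrite (bigD1 (Ordinal lt)) //= eqxx tofrac1 mul1r nth_index //.
by rewrite big1 ?addr0 // => i /negbTE ->; rewrite tofrac0 mul0r.
Qed.

Lemma ideal_span_submodule (gs : seq K) : submodule (ideal_span gs).
Proof.
split.
- by exists (fun=> 0); rewrite big1 // => i _; rewrite tofrac0 mul0r.
- move=> _ _ [c ->] [e ->]; exists (fun i => c i + e i).
  by rewrite -big_split; apply: eq_bigr => i _; rewrite tofracD mulrDl.
- move=> r _ [c ->]; exists (fun i => r * c i).
  by rewrite mulr_sumr; apply: eq_bigr => i _; rewrite tofracM mulrA.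
Qed.

Definition span (b : seq R) : set K := ideal_span (map iota b).

Lemma mem_span b r : r \in b -> span b (iota r).
Proof. by move=> rb; apply: mem_ideal_span; apply: map_f. Qed.

Lemma span_sub b T : submodule T ->
  (forall r, r \in b -> T (iota r)) -> span b `<=` T.
Proof.
move=> sT bT; apply: ideal_span_sub => // _ /mapP[r rb ->]; exact: bT.
Qed.

Lemma span_sub_base b : span b `<=` @base_ring R.
Proof.
apply: span_sub => [|r _]; last exact: base_ringP.
exact: fractional_submodule base_ring_fractional.
Qed.

Lemma span_fractional b r : r \in b -> r != 0 -> fractional_ideal (span b).
Proof.
move=> rb r0; have [S0 SD SZ] := ideal_span_submodule (map iota b).
split=> //.
- by exists (iota r); [exact: mem_span|rewrite tofrac_eq0].
- exists 1; first exact: oner_neq0.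
  by move=> x /span_sub_base; rewrite tofrac1 mul1r.
Qed.

(* Nakayama's determinant trick, for a possibly non-unital ring [S]. *)
Lemma determinant_trick n (g : 'I_n -> K) S :
    submodule S -> (forall x y, S x -> S y -> S (x * y)) ->
    (exists i, g i != 0) ->
    (forall i, exists2 c : 'I_n -> K, (forall j, S (c j)) &
       g i = \sum_(j < n) c j * g j) ->
  S 1.
Proof.
move=> [S0 SD SZ] SM [i0 gi0] gE.
have SN x : S x -> S (- x).
  by move=> /(SZ (-1)); rewrite tofracN tofrac1 mulN1r.
pose c i : 'I_n -> K := projT1 (cid2 (gE i)).
have cS i j : S (c i j) by rewrite /c; case: cid2.
have cE i : g i = \sum_j c i j * g j by rewrite /c; case: cid2.
pose A : 'M[K]_n := 1%:M - \matrix_(i, j) c i j.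
(* [A] kills the nonzero vector [g]; the transpose appears because [det0P] speaks of row vectors. *)
have detA0 : \det A = 0.
  rewrite -det_tr; apply/eqP/det0P; exists (\row_i g i).
    apply/eqP => /rowP /(_ i0); rewrite !mxE => h.
    by rewrite h eqxx in gi0.
  apply/rowP => i; rewrite !mxE.
  under eq_bigr => j _ do rewrite !mxE mulrBr.
  rewrite sumrB (bigD1 i) //= eqxx mulr1 big1 ?addr0; last first.
    by move=> j ji; rewrite eq_sym (negbTE ji) mulr0.
  rewrite [X in X - _]cE; apply/eqP; rewrite subr_eq0; apply/eqP.
  by apply: eq_bigr => j _; rewrite mulrC.
(* Congruence modulo [S] to an element of [R], compatible with sums and products although [S] may
   lack 1. As [A] reduces to the identity, its determinant 0 is congruent to 1. *)
pose cong (x a : K) := base_ring a /\ S (x - a).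
have [B0 BD BZ] := fractional_submodule base_ring_fractional.
have BM : forall a b : K, base_ring a -> base_ring b -> base_ring (a * b).
  by move=> _ b [r _ <-]; apply: BZ.
have congD x a y b : cong x a -> cong y b -> cong (x + y) (a + b).
  by move=> [? ?] [? ?]; split; [exact: BD|rewrite opprD addrACA; exact: SD].
have congM x a y b : cong x a -> cong y b -> cong (x * y) (a * b).
  move=> [[r _ <-] h] [[s _ <-] k]; split; first by apply: BM; exact: base_ringP.
  have -> : x * y - iota r * iota s = (x - iota r) * (y - iota s)
     + (iota r * (y - iota s) + iota s * (x - iota r)) by ring.
  by apply: (SD); [exact: SM|apply: (SD); exact: SZ].
have congn k : cong k%:R k%:R.
  split; last by rewrite subrr.
  by exists k%:R => //; rewrite rmorph_nat.
have cong1 : cong (\det A) (\det (1%:M : 'M[K]_n)).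
  rewrite /determinant; elim/big_ind2: _ => [|x a y b|s _].
  - exact: (congn 0%N).
  - exact: congD.
  apply: (congM).
    elim: (nat_of_bool _) => [|k IH]; first by rewrite expr0; exact: (congn 1%N).
    rewrite exprS; apply: (congM) => //; split; last by rewrite subrr.
    by exists (-1) => //; rewrite tofracN tofrac1.
  elim/big_ind2: _ => [|x a y b|i _]; first exact: (congn 1%N).
    exact: congM.
  rewrite !mxE; split.
    by exists (i == s i)%:R => //; rewrite rmorph_nat.
  by rewrite addrAC subrr add0r; apply: SN.
case: cong1 => _; rewrite detA0 det1 sub0r => /SN; by rewrite opprK.
Qed.

End Submodules.

(** * Localization of submodules at a prime *)

Section Localization.
Variable R : idomainType.
Local Notation K := {fraction R}.
Local Notation iota := (@tofrac R).
Variable P : set K.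
Hypothesis primeP : prime_ideal P.
Implicit Types (I J T X : set K) (r s : R) (x y : K).

(** For a submodule [I] this is the extension $I R_P$, written with one denominator instead of a
    finite sum of products; see [mem_localization_mul]. *)
Definition loc I : set K := [set x | exists2 s, ~ P (iota s) & I (iota s * x)].

Lemma prime_not1 : ~ P 1.
Proof.
case: primeP => -[[_ _ PZ _ _] PR] nPR _ P1; apply: nPR.
apply/seteqP; split=> // _ [r _ <-].
by rewrite -[iota r]mulr1; apply: PZ.
Qed.

Lemma prime_notM r s : ~ P (iota r) -> ~ P (iota s) -> ~ P (iota (r * s)).
Proof. by case: primeP => _ _ PM nr ns /PM[]. Qed.

Lemma prime_not_neq0 s : ~ P (iota s) -> iota s != 0.
Proof.
case: primeP => -[[P0 _ _ _ _] _] _ _ ns; apply/eqP => s0.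
by apply: ns; rewrite s0.
Qed.

Lemma sub_loc I : I `<=` loc I.
Proof. by move=> x Ix; exists 1; rewrite tofrac1 ?mul1r //; exact: prime_not1. Qed.

Lemma loc_submodule I : submodule I -> submodule (loc I).
Proof.
move=> [I0 ID IZ]; split; first exact: sub_loc.
- move=> x y [s ns sx] [t nt ty]; exists (s * t); first exact: prime_notM.
  have -> : iota (s * t) * (x + y) = iota t * (iota s * x) + iota s * (iota t * y).
    by rewrite tofracM; ring.
  by apply: ID; apply: IZ.
- by move=> r x [s ns sx]; exists s => //; rewrite mulrCA; apply: IZ.
Qed.

Lemma loc_denom I s x : ~ P (iota s) -> loc I (iota s * x) -> loc I x.
Proof.
move=> ns [t nt h]; exists (t * s); first exact: prime_notM.
by rewrite tofracM -mulrA.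
Qed.

Lemma loc_mono I J : I `<=` loc J -> loc I `<=` loc J.
Proof. by move=> IJ x [s ns /IJ]; exact: loc_denom. Qed.

Lemma mem_localization_mul I x : submodule I ->
  ideal_mul I (localization P) x <-> loc I x.
Proof.
move=> sI; split.
  move: x; apply: ideal_mul_sub; first exact: loc_submodule.
  move=> x _ Ix [a [s [ns ->]]]; exists s => //.
  have s0 := prime_not_neq0 ns.
  have -> : iota s * (x * (iota a / iota s)) = iota a * x.
    by rewrite mulrCA [iota s * _]mulrC divfK // mulrC.
  by case: sI => _ _; apply.
move=> [s ns sx]; have s0 := prime_not_neq0 ns.
have -> : x = (iota s * x) * (iota 1 / iota s).
  by rewrite tofrac1 mul1r [RHS]mulrC mulKf.
by apply: mem_ideal_mul => //; exists 1, s.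
Qed.

End Localization.

(** * Star operations given by a family of primes *)

Section CliffordRegular.
Variable R : idomainType.
Local Notation K := {fraction R}.
Local Notation iota := (@tofrac R).
Variable star : set K -> set K.
Hypothesis hstar : star_operation star.
Hypothesis hft : star_finite_type star.
Variable G : set (set K).
Hypothesis primeG : forall P, G P -> prime_ideal P.
Hypothesis starG : forall I, fractional_ideal I ->
  star I = \bigcap_(P in G) ideal_mul I (localization P).
Hypothesis hclifford : clifford_star_regular star.
Implicit Types (I J M N P T X : set K) (r s : R) (x y : K) (b : seq R).

(** The form in which the spectral hypothesis is used: single denominators replace the finite sums
    in the extensions to $R_P$. *)
Lemma star_locP I x : fractional_ideal I ->
  star I x <-> forall P, G P -> loc P I x.
Proof.
move=> fI; rewrite starG //; have sI := fractional_submodule fI.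
split=> h P GP; apply/(mem_localization_mul (primeG GP) _ sI); exact: h.
Qed.

Lemma star_loc I P : fractional_ideal I -> G P -> star I `<=` loc P I.
Proof. by move=> fI GP x /(star_locP _ fI); apply. Qed.

Definition inside b I : Prop := forall r, r \in b -> I (iota r).

Lemma loc_span_unit b P : G P -> loc P (span b) 1 -> ~ inside b P.
Proof.
move=> GP [s ns h] bP; apply: ns; rewrite -[iota s]mulr1.
apply: (span_sub _ bP) h.
by case: (primeG GP) => -[fP _] _ _; exact: fractional_submodule.
Qed.

(** * [star]-maximal ideals and pairwise comaximal sequences *)

Lemma star_max_not1 M : star_max star M -> ~ M 1.
Proof.
case=> -[[fM MR] nM _] _ M1; apply: nM; apply/seteqP; split=> // _ [r _ <-].
by rewrite -[iota r]mulr1; case: fM => _ _ MZ _ _; apply: MZ.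
Qed.

Lemma star_max_fractional M : star_max star M -> fractional_ideal M.
Proof. by case=> -[[]]. Qed.

Lemma star_span_max M b : star_max star M -> fractional_ideal (span b) ->
  inside b M -> ~ star (span b) 1.
Proof.
move=> mM fb bM h; apply: (star_max_not1 mM).
have fM := star_max_fractional mM.
case: (mM) => -[_ _ <-] _; apply: (star_monotone hstar fb fM) h.
by apply: span_sub => //; exact: fractional_submodule.
Qed.

(** By maximality the closure of $M + rR$ is $R$, and finite type puts 1 in the closure of a
    finitely generated subideal. Its generators have the form $m + s r$; the finitely many $m$ make
    up [b]. *)
Lemma star_max_comaximal M r : star_max star M -> ~ M (iota r) ->
  exists2 b, inside b M & star (span (r :: b)) 1.
Proof.
move=> mM nr; have fM := star_max_fractional mM.
have MR : M `<=` @base_ring R by case: mM => -[[]].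
have [M0 MD MZ] := fractional_submodule fM.
pose I : set K := [set x | exists2 y, M y & exists s, x = y + iota (s * r)].
have MI : M `<=` I by move=> y My; exists y => //; exists 0; rewrite mul0r tofrac0 addr0.
have IR : I `<=` @base_ring R.
  by move=> _ [_ /MR[a _ <-] [s ->]]; exists (a + s * r) => //; rewrite tofracD.
have fI : fractional_ideal I.
  split.
  - exact: MI.
  - move=> _ _ [y My [s ->]] [z Mz [t ->]]; exists (y + z); first exact: MD.
    by exists (s + t); rewrite mulrDl !tofracD addrACA.
  - move=> a _ [y My [s ->]]; exists (iota a * y); first exact: MZ.
    by exists (a * s); rewrite mulrDr -mulrA (tofracM a).
  - by case: fM => _ _ _ [y My y0] _; exists y => //; exact: MI.
  - by exists 1; [exact: oner_neq0|move=> x /IR; rewrite tofrac1 mul1r].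
(* Otherwise [star I] would be a proper [star]-ideal containing [M], hence equal to [M], and [r]
   would lie in [M]. *)
have sI1 : star I 1.
  apply: contrapT => n1; apply: nr.
  have sIM : star I `<=` @base_ring R.
    rewrite -{1}(star_base_ring hstar).
    by apply: (star_monotone hstar fI _ IR); exact: base_ring_fractional.
  have psI : proper_integral_star_ideal star (star I).
    split; [split=> //; exact: (star_ideal hstar)| |exact: (star_idempotent hstar)].
    by move=> h; apply: n1; rewrite h; exists 1 => //; rewrite tofrac1.
  case: mM => _ /(_ _ psI) <-; last first.
    by move=> x /MI; exact: (star_extensive hstar).
  apply: (star_extensive hstar) => //; exists 0 => //.
  by exists 1; rewrite mul1r add0r.
move: sI1; rewrite hft // => -[F [[fF [gs FE]] FI] F1].
have H x : x \in gs -> exists2 t, M (iota t) & exists s, x = iota t + iota (s * r).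
  move=> xgs; have [y My [s ->]] : I x by apply: FI; rewrite FE; exact: mem_ideal_span.
  by have [t _ ty] := MR _ My; exists t; rewrite ty //; exists s.
have [b bM gb] : exists2 b, inside b M & forall x, x \in gs -> span (r :: b) x.
  elim: gs H {FE} => [|x gs IH] H; first by exists [::].
  have [|b bM gb] := IH; first by move=> y ygs; apply: H; rewrite inE ygs orbT.
  have [t Mt [s xE]] := H x (mem_head _ _).
  exists (t :: b); first by move=> u; rewrite inE => /predU1P[->|/bM].
  have [S0 SD SZ] := ideal_span_submodule (map iota [:: r, t & b]).
  move=> y; rewrite inE => /predU1P[->|/gb].
    rewrite xE tofracM; apply: SD.
      by apply: mem_span; rewrite !inE eqxx orbT.
    by apply: SZ; apply: mem_span; rewrite inE eqxx.
  apply: span_sub => // u; rewrite inE => ub; apply: mem_span.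
  by rewrite !inE; case/orP: ub => ->; rewrite ?orbT.
exists b => //.
have r0 : r != 0 by apply/eqP => r0; apply: nr; rewrite r0 tofrac0.
have fb : fractional_ideal (span (r :: b)).
  by apply: span_fractional r0; exact: mem_head.
apply: (star_monotone hstar fF fb) F1; rewrite FE; apply: ideal_span_sub => //.
exact: ideal_span_submodule.
Qed.

(* Otherwise every finitely generated ideal contained in a member of [V] is
   contained in all but finitely many members of [V]; this fails for one of two
   [*]-comaximal ideals contained in distinct members of [V]. *)
Lemma infinite_avoiding (V : set (set K)) : V `<=` star_max star ->
  ~ finite_set V -> exists M r, [/\ V M, M (iota r) &
    ~ finite_set [set L | V L /\ ~ L (iota r)]].
Proof.
move=> VM infV; apply: contrapT => nex.
have fin M r : V M -> M (iota r) -> finite_set [set L | V L /\ ~ L (iota r)].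
  by move=> VMM Mr; apply: contrapT => nf; apply: nex; exists M, r.
have fins M b : V M -> inside b M -> finite_set [set L | V L /\ ~ inside b L].
  move=> VMM; elim: b => [|r b IH] bM.
    by apply: (sub_finite_set _ (finite_set0 _)) => L [_]; apply=> ?.
  apply: (@sub_finite_set _ _ ([set L | V L /\ ~ L (iota r)] `|`
      [set L | V L /\ ~ inside b L])).
    move=> L [VL nL]; have [Lr|Lr] := pselect (L (iota r)); last by left.
    right; split=> // Lb; apply: nL => s; rewrite inE => /predU1P[->//|].
    exact: Lb.
  rewrite finite_setU; split; first by apply: (fin M) => //; apply: bM; exact: mem_head.
  by apply: IH => s sb; apply: bM; rewrite inE sb orbT.
have [M VMM] : exists M, V M.
  apply: contrapT => n; apply: infV.
  by apply: (sub_finite_set _ (finite_set0 _)) => L VL; apply: n; exists L.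
have [N VN NM] : exists2 N, V N & N <> M.
  apply: contrapT => n; apply: infV; apply: (sub_finite_set _ (finite_set1 M)).
  by move=> L VL; apply: contrapT => LM; apply: n; exists L.
have [mM mN] := (VM _ VMM, VM _ VN).
have [r Mr nNr] : exists2 r, M (iota r) & ~ N (iota r).
  apply: contrapT => n; apply: NM; case: (mM) => -[[_ MR] _ _]; apply.
    by case: mN.
  move=> x Mx; have [r _ rx] := MR _ Mx; rewrite -rx in Mx *.
  by apply: contrapT => nNr; apply: n; exists r.
have [b bN h] := star_max_comaximal mN nNr.
have r0 : r != 0.
  apply/eqP => r0; apply: nNr; rewrite r0 tofrac0.
  by have [] := fractional_submodule (star_max_fractional mN).
have fb : fractional_ideal (span (r :: b)).
  by apply: span_fractional r0; exact: mem_head.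
apply: infV; apply: (@sub_finite_set _ _ ([set L | V L /\ ~ L (iota r)] `|`
      [set L | V L /\ ~ inside b L])); last first.
  by rewrite finite_setU; split; [exact: fin VMM Mr|exact: fins VN bN].
move=> L VL; have [Lr|Lr] := pselect (L (iota r)); last by left.
right; split=> // bL; apply: (star_span_max (VM _ VL) fb) h.
by move=> s; rewrite inE => /predU1P[->|/bL].
Qed.

(** Iterates [infinite_avoiding]: once [M n] and [a n] are chosen, only the infinitely many members
    avoiding [a n] are kept for later choices. *)
Lemma avoiding_sequence (V : set (set K)) : V `<=` star_max star ->
  ~ finite_set V -> exists (M : nat -> set K) (a : nat -> R),
    [/\ forall n, V (M n), forall n, M n (iota (a n))
      & forall n m, (n < m)%N -> ~ M m (iota (a n))].
Proof.
move=> VM infV.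
pose D := {W : set (set K) | W `<=` V /\ ~ finite_set W}.
have step (W : D) : {p : set K * R | [/\ sval W p.1, p.1 (iota p.2) &
    ~ finite_set [set L | sval W L /\ ~ L (iota p.2)]]}.
  apply: cid; have [sWV infW] := svalP W.
  have [|M [r h]] := infinite_avoiding _ infW; first exact: subset_trans VM.
  by exists (M, r).
have next_proof (W : D) : let W' := [set L | sval W L /\ ~ L (iota (sval (step W)).2)] in
    W' `<=` V /\ ~ finite_set W'.
  split; last by case: (svalP (step W)).
  by move=> L [WL _]; case: (svalP W) => sWV _; exact: sWV.
pose next (W : D) : D := exist _ _ (next_proof W).
pose W n : D := iter n next (exist _ V (conj (@subset_refl _ V) infV)).
have Wdec n k L : sval (W (k + n)%N) L -> sval (W n) L.
  by elim: k => // k IH [h _]; exact: IH.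
exists (fun n => (sval (step (W n))).1), (fun n => (sval (step (W n))).2); split.
- move=> n; case: (svalP (step (W n))) => h _ _.
  by case: (svalP (W n)) => sWV _; exact: sWV.
- by move=> n; case: (svalP (step (W n))).
- move=> n m nm; case: (svalP (step (W m))) => h _ _.
  (* [n < m] is [n.+1 <= m], so [M m] belongs to [W n.+1], whose members avoid [a n]. *)
  by move: h; rewrite -{1}(subnK nm) => /Wdec[].
Qed.

(** For [n < m], [b n] contains [a n] and [b m] contains a list [c n m] that is [star]-comaximal
    with [a n], so no prime of [G] contains both. *)
Lemma comaximal_sequence r0 : r0 != 0 ->
  ~ finite_set [set M | star_max star M /\ M (iota r0)] ->
  exists b : nat -> seq R,
    [/\ forall n, r0 \in b n,
        forall n, exists2 P, G P & inside (b n) P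
      & forall n m P, G P -> inside (b n) P -> inside (b m) P -> n = m].
Proof.
move=> r00 inf.
have [|M [a [MV Ma Mna]]] := avoiding_sequence _ inf; first by move=> M [].
have mM n : star_max star (M n) by case: (MV n).
have ex n m : exists b, inside b (M m) /\ ((n < m)%N -> star (span (a n :: b)) 1).
  (* For [m <= n] the empty list is a dummy value that makes [c] total. *)
  have [nm|] := boolP (n < m)%N; last by exists [::]; split.
  by have [b bM h] := star_max_comaximal (mM m) (Mna n m nm); exists b.
have [c cP] : exists c : nat -> nat -> seq R, forall n m,
    inside (c n m) (M m) /\ ((n < m)%N -> star (span (a n :: c n m)) 1).
  by exists (fun n m => sval (cid (ex n m))) => n m; case: cid.
have an0 n : a n != 0.
  apply/eqP => a0; apply: (Mna n n.+1) => //; rewrite a0 tofrac0.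
  by have [] := fractional_submodule (star_max_fractional (mM n.+1)).
(* [r0] is put in every list to provide, later, a denominator common to all quotients. *)
pose b m := [:: r0, a m & flatten [seq c n m | n <- seq.iota 0 m]].
have lt_comax n m P : (n < m)%N -> G P -> inside (b n) P -> ~ inside (b m) P.
  move=> nm GP bn bm; have [_ /(_ nm) h] := cP n m.
  apply: (@loc_span_unit (a n :: c n m) P GP).
    apply: star_loc h => //; apply: span_fractional (an0 n); exact: mem_head.
  move=> r; rewrite inE => /predU1P[->|rc].
    by apply: bn; rewrite !inE eqxx orbT.
  apply: bm; rewrite !inE; apply/orP; right; apply/orP; right.
  by apply/flattenP; exists (c n m) => //; apply: map_f; rewrite mem_iota.
exists b; split=> [n|n|n m P GP bn bm]; first exact: mem_head.
  have fb : fractional_ideal (span (b n)).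
    by apply: span_fractional r00; exact: mem_head.
  have bM : inside (b n) (M n).
    move=> r; rewrite !inE => /or3P[/eqP->|/eqP->|]; first by case: (MV n).
      exact: Ma.
    by case/flattenP => _ /mapP[k _ ->]; case: (cP k n) => h _; exact: h.
  (* Since [b n] lies in [M n], 1 is not in [star (span (b n))]; this yields a prime of [G]
     containing [b n], which need not be [M n]. *)
  apply: contrapT => nP; apply: (star_span_max (mM n) fb bM).
  apply/star_locP => // P GP; apply: contrapT => n1; apply: nP; exists P => // r rb.
  apply: contrapT => nr; apply: n1; exists r => //; rewrite mulr1; exact: mem_span.
case: (ltngtP n m) => // nm; first by case: (lt_comax n m P).
by case: (lt_comax m n P).
Qed.

(* With [I = span b], [(I X)_P] is closed under products, as [(I^2 X) X] lies in
   [(I X)_P], and [I] lies in [I (I X)_P]: the determinant trick applies. *)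
Lemma clifford_fg_unit b r0 X P : r0 \in b -> r0 != 0 -> fractional_ideal X ->
  star (span b) = star (ideal_mul (ideal_mul (span b) (span b)) X) -> G P ->
  loc P (ideal_mul (span b) X) 1.
Proof.
move=> rb r00 fX eqX GP; have pP := primeG GP; set I := span b.
have fI : fractional_ideal I by apply: span_fractional rb r00.
have sI := fractional_submodule fI; have sX := fractional_submodule fX.
have sIX := ideal_mul_submodule X sI.
have fIIX : fractional_ideal (ideal_mul (ideal_mul I I) X).
  by apply: ideal_mul_fractional => //; exact: ideal_mul_fractional.
have sL : submodule (loc P (ideal_mul I X)) by exact: loc_submodule.
have [L0 LD LZ] := sL.
pose gs := map iota b; pose g (i : 'I_(size gs)) := gs`_i.
apply: (@determinant_trick R _ g) => //.
- have IIX_loc : ideal_mul (ideal_mul I I) X `<=` loc P I.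
    move=> x h; apply: (star_loc fI GP).
    by rewrite eqX; exact: (star_extensive hstar).
  have mulIX x y : ideal_mul I X x -> ideal_mul I X y -> loc P (ideal_mul I X) (x * y).
    move=> hx hy; move: x hx.
    apply: (@ideal_mul_sub R _ _ [set x | loc P (ideal_mul I X) (x * y)]) => /=.
      exact: preim_mulr_submodule.
    move=> u v Iu Xv; move: y hy.
    apply: (@ideal_mul_sub R _ _ [set y | loc P (ideal_mul I X) (u * v * y)]) => /=.
      exact: preim_mull_submodule.
    move=> w z Iw Xz.
    have [s ns h] : loc P I (u * w * v) by apply: IIX_loc; do 2! apply: mem_ideal_mul => //.
    exists s => //.
    have -> : iota s * (u * v * (w * z)) = (iota s * (u * w * v)) * z by ring.
    exact: mem_ideal_mul.
  move=> x y [s ns sx] [t nt ty]; apply: (@loc_denom _ _ pP _ (s * t)).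
    exact: prime_notM.
  have -> : iota (s * t) * (x * y) = (iota s * x) * (iota t * y).
    by rewrite tofracM; ring.
  exact: mulIX.
- have lt : (index (iota r0) gs < size gs)%N by rewrite index_mem map_f.
  exists (Ordinal lt); rewrite /g nth_index ?map_f //.
  by rewrite tofrac_eq0.
move=> i.
(* [T] is $I (IX)_P$ in terms of the generators. It contains $I^2 X$, and the denominator [s] below
   is absorbed by the localized coefficients. *)
pose T : set K := [set x | exists2 c : 'I_(size gs) -> K,
  (forall j, loc P (ideal_mul I X) (c j)) & x = \sum_j c j * g j].
have sT : submodule T.
  split.
  - by exists (fun=> 0) => //; rewrite big1 // => j _; rewrite mul0r.
  - move=> _ _ [c hc ->] [d hd ->]; exists (fun j => c j + d j).
      by move=> j; exact: LD.
    by rewrite -big_split; apply: eq_bigr => j _; rewrite mulrDl.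
  - move=> r _ [c hc ->]; exists (fun j => iota r * c j).
      by move=> j; exact: LZ.
    by rewrite mulr_sumr; apply: eq_bigr => j _; rewrite mulrA.
have IIXT : ideal_mul (ideal_mul I I) X `<=` T.
  apply: ideal_mul_sub => // u v IIu Xv; move: u IIu.
  apply: (@ideal_mul_sub R _ _ [set u | T (u * v)]).
    exact: preim_mulr_submodule.
  move=> u w Iu [c ->] /=; exists (fun j => iota (c j) * (u * v)).
    by move=> j; apply: LZ; apply: sub_loc => //; exact: mem_ideal_mul.
  rewrite mulr_sumr mulr_suml; apply: eq_bigr => j _; rewrite /g; ring.
have Ig : I (g i) by apply: mem_ideal_span; exact: mem_nth.
have : star I (g i) by exact: (star_extensive hstar).
rewrite eqX => /(star_loc fIIX GP)[s ns /IIXT[c hc sg]].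
have s0 := prime_not_neq0 pP ns.
exists (fun j => c j / iota s).
  move=> j; apply: (loc_denom pP ns).
  by have -> : iota s * (c j / iota s) = c j by rewrite mulrC divfK.
have -> : g i = (iota s * g i) / iota s by rewrite [RHS]mulrC mulKf.
by rewrite sg mulr_suml; apply: eq_bigr => j _; rewrite mulrAC.
Qed.

(* [(I^* : I^2)] plays the role of the inverse of [I] over [(I^* : I^* )]. *)
Definition quot I : set K :=
  [set x | forall u v, I u -> I v -> star I (x * (u * v))].

(** * Local properties of the quotient of a finitely generated ideal *)

Section Quotient.
Variables (b : seq R) (r0 : R).
Hypothesis rb : r0 \in b.
Hypothesis r00 : r0 != 0.
Let I := span b.

Let fI : fractional_ideal I. Proof. exact: span_fractional rb r00. Qed.
Let fsI : fractional_ideal (star I). Proof. exact: star_ideal. Qed.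
Let ssI : submodule (star I). Proof. exact: fractional_submodule. Qed.

Let sIR : star I `<=` @base_ring R.
Proof.
rewrite -(star_base_ring hstar); apply: (star_monotone hstar fI).
  exact: base_ring_fractional.
exact: span_sub_base.
Qed.

Lemma quot_submodule : submodule (quot I).
Proof.
have [I0 ID IZ] := ssI; split.
- by move=> u v _ _; rewrite mul0r.
- by move=> x y hx hy u v Iu Iv; rewrite mulrDl; apply: ID; [exact: hx|exact: hy].
- by move=> r x hx u v Iu Iv; rewrite -mulrA; apply: IZ; exact: hx.
Qed.

Lemma base_ring_quot : @base_ring R `<=` quot I.
Proof.
have [_ _ IZ] := ideal_span_submodule (map iota b).
move=> _ [r _ <-] u v /span_sub_base[s _ <-] Iv.
by apply: (star_extensive hstar fI); do 2! apply: (IZ).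
Qed.

(** Taking [r0] for both elements of $I$ gives a denominator independent of [b], as
    [total_fractional] needs. *)
Lemma quot_denom x : quot I x -> base_ring (iota (r0 * r0) * x).
Proof. by move=> hx; apply: sIR; rewrite mulrC tofracM; apply: hx; exact: mem_span. Qed.

Lemma quot_loc_base P : G P -> ~ inside b P -> quot I `<=` loc P (@base_ring R).
Proof.
move=> GP nbP x hx.
have [s sb ns] : exists2 s, s \in b & ~ P (iota s).
  apply: contrapT => n; apply: nbP => s sb; apply: contrapT => ns; apply: n.
  by exists s.
exists (s * s); first exact: (prime_notM (primeG GP)).
by apply: sIR; rewrite mulrC tofracM; apply: hx; exact: mem_span.
Qed.

(** For [v], [w] in $I$, the element $z v w$ lies in $I$ up to a denominator at each prime, so $x u
    (z v w)$ is covered by the condition on [x]. *)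
Lemma quot_mul x u z : quot I x -> I u -> quot I z -> quot I (x * u * z).
Proof.
move=> hx Iu hz v w Iv Iw; apply/star_locP => // P GP; have pP := primeG GP.
have [s ns h] := star_loc fI GP (hz v w Iv Iw).
apply: (loc_denom pP ns); apply: (star_loc fI GP).
have -> : iota s * (x * u * z * (v * w)) = x * (u * (iota s * (z * (v * w)))) by ring.
exact: hx.
Qed.

(** The ideal [X] given by Clifford regularity lies in [quot I], because $I^2 X$ lies in the closure
    of $I$; so [clifford_fg_unit] applies. *)
Lemma quot_unit P : G P -> loc P (ideal_mul I (quot I)) 1.
Proof.
move=> GP; have [X fX eqX] := hclifford fI.
have fII : fractional_ideal (ideal_mul I I) by exact: ideal_mul_fractional.
have fIIX : fractional_ideal (ideal_mul (ideal_mul I I) X).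
  exact: ideal_mul_fractional.
have [s ns h] := clifford_fg_unit rb r00 fX eqX GP.
exists s => //; apply: ideal_mul_sub h.
  exact: ideal_mul_submodule (ideal_span_submodule _).
move=> x y Ix Xy; apply: mem_ideal_mul => // u v Iu Iv.
rewrite mulrC eqX; apply: (star_extensive hstar) => //.
by do 2! apply: mem_ideal_mul => //.
Qed.

(** Squaring [quot_unit] puts 1 in $(I^2 Q^2)_P$. If $Q^2$ were in $Q_P$, then 1 would be in $(I^2
    Q)_P$, hence in $I_P$, against [loc_span_unit]. *)
Lemma quot_not_idempotent P : G P -> inside b P ->
  ~ (forall x y, quot I x -> quot I y -> loc P (quot I) (x * y)).
Proof.
move=> GP bP QQ; have pP := primeG GP.
have [s ns h] := quot_unit GP.
have sL : submodule (loc P I).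
  by apply: loc_submodule => //; exact: fractional_submodule.
apply: (@loc_span_unit b P GP) bP.
apply: (@loc_denom _ _ pP _ (s * s)); first exact: prime_notM.
rewrite mulr1 tofracM; move: h; rewrite mulr1; move: (iota s) => t ht.
(* The two factors of [t * t] are expanded in $I Q$ one after the other, the claim being linear in
   each. *)
have : [set y | loc P I (t * y)] t; last by [].
apply: ideal_mul_sub (ht); first exact: preim_mull_submodule.
move=> u x Iu hx /=.
have : [set y | loc P I (y * (u * x))] t; last by [].
apply: ideal_mul_sub (ht); first exact: preim_mulr_submodule.
move=> v y Iv hy /=; have [a na h] := QQ x y hx hy.
apply: (@loc_denom _ _ pP _ a) => //; apply: star_loc => //.
have -> : iota a * (v * y * (u * x)) = iota a * (x * y) * (u * v) by ring.
exact: h.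
Qed.

End Quotient.

(** * The sum of the quotients along a pairwise comaximal sequence *)

Section ComaximalSequence.
Variables (b : nat -> seq R) (r0 : R).
Hypothesis rb : forall n, r0 \in b n.
Hypothesis r00 : r0 != 0.
Hypothesis comax : forall n m P, G P -> inside (b n) P -> inside (b m) P -> n = m.
Hypothesis proper : forall n, exists2 P, G P & inside (b n) P.

Let Q n := quot (span (b n)).
Let sQ n : submodule (Q n). Proof. exact: quot_submodule (rb n) r00. Qed.

(** The term [Q n] is left out on purpose, so that [partial_sum n] becomes trivial at a prime
    containing [b n]. *)
Fixpoint partial_sum n : set K :=
  if n is m.+1 then [set x | exists2 y, partial_sum m y & exists2 z, Q m z & x = y + z]
  else @base_ring R.

Let total : set K := [set x | exists n, partial_sum n x].

Lemma partial_sum_submodule n : submodule (partial_sum n).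
Proof.
elim: n => [|n [S0 SD SZ]].
  exact: fractional_submodule (base_ring_fractional R).
have [Q0 QD QZ] := sQ n; split.
- by exists 0 => //; exists 0 => //; rewrite addr0.
- move=> _ _ [y Sy [z Qz ->]] [y' Sy' [z' Qz' ->]].
  exists (y + y'); first exact: SD.
  by exists (z + z'); [exact: QD|rewrite addrACA].
- move=> r _ [y Sy [z Qz ->]]; exists (iota r * y); first exact: SZ.
  by exists (iota r * z); [exact: QZ|rewrite mulrDr].
Qed.

Lemma partial_sum_le n m : (n <= m)%N -> partial_sum n `<=` partial_sum m.
Proof.
move=> /subnK <-; elim: (m - n)%N => // k IH x /IH h; exists x => //.
by exists 0; [case: (sQ (k + n))|rewrite addr0].
Qed.

Lemma partial_sum_sub n T : submodule T -> @base_ring R `<=` T ->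
  (forall k, (k < n)%N -> Q k `<=` T) -> partial_sum n `<=` T.
Proof.
move=> sT RT; elim: n => [|n IH] QT; first exact: RT.
have [_ TD _] := sT.
move=> _ [y Sy [z Qz ->]]; apply: TD; last exact: QT Qz.
by apply: IH Sy => k kn; apply: QT; exact: ltnW.
Qed.

Lemma quot_total n : Q n `<=` total.
Proof.
move=> x Qx; exists n.+1; exists 0; first by case: (partial_sum_submodule n).
by exists x => //; rewrite add0r.
Qed.

Lemma base_ring_total : @base_ring R `<=` total.
Proof. by move=> x Rx; exists 0%N. Qed.

Lemma total_fractional : fractional_ideal total.
Proof.
split.
- by exists 0%N; case: (partial_sum_submodule 0).
- move=> x y [n Sx] [m Sy]; exists (maxn n m).
  have [_ SD _] := partial_sum_submodule (maxn n m).
  by apply: SD; [apply: partial_sum_le Sx|apply: partial_sum_le Sy];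
    rewrite ?leq_maxl ?leq_maxr.
- by move=> r x [n Sx]; exists n; case: (partial_sum_submodule n) => _ _; apply.
- exists 1; last exact: oner_neq0.
  by apply: base_ring_total; exists 1 => //; rewrite tofrac1.
(* One denominator serves all quotients, as [r0] belongs to every [b k]. *)
- exists (r0 * r0); first by rewrite mulf_neq0.
  move=> x [n]; move: x.
  have sR := fractional_submodule (base_ring_fractional R).
  apply: partial_sum_sub; first exact: preim_mull_submodule.
    by move=> _ [r _ <-] /=; exists (r0 * r0 * r) => //; rewrite -tofracM.
  by move=> k _ x; exact: (quot_denom (rb k) r00).
Qed.

Lemma total_loc_base P : G P -> (forall n, ~ inside (b n) P) ->
  total `<=` loc P (@base_ring R).
Proof.
move=> GP nbP x [n]; move: x; have pP := primeG GP.
have sR := fractional_submodule (base_ring_fractional R).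
apply: partial_sum_sub; [exact: loc_submodule|exact: sub_loc|].
by move=> k _; exact: (quot_loc_base (rb k) r00 GP).
Qed.

Lemma partial_sum_loc_base n P : G P -> inside (b n) P ->
  partial_sum n `<=` loc P (@base_ring R).
Proof.
move=> GP bP; have pP := primeG GP.
have sR := fractional_submodule (base_ring_fractional R).
apply: partial_sum_sub; [exact: loc_submodule|exact: sub_loc|].
move=> k kn; apply: (quot_loc_base (rb k) r00 GP) => bk.
by rewrite (comax GP bk bP) ltnn in kn.
Qed.

(** By comaximality the quotients other than [Q n] fall into $R_P$, which lies in $(Q_n)_P$. *)
Lemma total_loc_quot n P : G P -> inside (b n) P -> total `<=` loc P (Q n).
Proof.
move=> GP bP x [k]; move: x; have pP := primeG GP.
have RQ : @base_ring R `<=` loc P (Q n).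
  move=> x /(base_ring_quot (rb n) r00); exact: sub_loc.
apply: partial_sum_sub => [|//|m _]; first exact: loc_submodule.
have [->|mn] := eqVneq m n; first exact: sub_loc.
have nb : ~ inside (b m) P by move=> bm; move: mn; rewrite (comax GP bm bP) eqxx.
by apply: subset_trans (quot_loc_base (rb m) r00 GP nb) _; exact: loc_mono.
Qed.

Lemma partial_sum_mul_le n m X : (n <= m)%N ->
  ideal_mul (partial_sum n) X `<=` ideal_mul (partial_sum m) X.
Proof.
move=> nm; apply: ideal_mul_sub.
  by apply: ideal_mul_submodule; exact: partial_sum_submodule.
by move=> u v /(partial_sum_le nm) Su Xv; exact: mem_ideal_mul.
Qed.

(** The partial sums increase, so the finitely many terms of an element of the product fit in one of
    them. *)
Lemma mul_total_fin X x : ideal_mul total X x ->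
  exists n, ideal_mul (partial_sum n) X x.
Proof.
move: x; apply: (@ideal_mul_sub R _ _
  [set x | exists n, ideal_mul (partial_sum n) X x]).
  split=> /=.
  - by exists 0%N; case: (ideal_mul_submodule X (partial_sum_submodule 0)).
  - move=> x y [n hx] [m hy]; exists (maxn n m).
    have [_ SD _] := ideal_mul_submodule X (partial_sum_submodule (maxn n m)).
    by apply: SD; [apply: partial_sum_mul_le hx|apply: partial_sum_mul_le hy];
      rewrite ?leq_maxl ?leq_maxr.
  - move=> r x [n hx]; exists n.
    by have [_ _] := ideal_mul_submodule X (partial_sum_submodule n); apply.
by move=> x y [n Sx] Xy; exists n; exact: mem_ideal_mul.
Qed.

Lemma span_mul_total_fin X (gs : seq K) : ideal_span gs `<=` ideal_mul total X ->
  exists n, ideal_span gs `<=` ideal_mul (partial_sum n) X.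
Proof.
move=> gX.
have gX' x : x \in gs -> exists n, ideal_mul (partial_sum n) X x.
  by move=> xgs; apply: mul_total_fin; apply: gX; exact: mem_ideal_span.
have [n h] : exists n, forall x, x \in gs -> ideal_mul (partial_sum n) X x.
  elim: gs gX' {gX} => [|g gs IH] gX; first by exists 0%N.
  have [|n hn] := IH; first by move=> x xgs; apply: gX; rewrite inE xgs orbT.
  have [m hm] := gX g (mem_head _ _).
  exists (maxn n m) => x; rewrite inE => /predU1P[->|/hn].
    by apply: partial_sum_mul_le hm; exact: leq_maxr.
  by apply: partial_sum_mul_le; exact: leq_maxl.
exists n; apply: ideal_span_sub => //.
by apply: ideal_mul_submodule; exact: partial_sum_submodule.
Qed.

(** One factor $T$, standing for [total], must be cancelled from the Clifford relation: by
    [quot_unit] where [P] contains some [b n], and by triviality of [total] elsewhere. *)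
Lemma clifford_total_unit X P : fractional_ideal X ->
  star total = star (ideal_mul (ideal_mul total total) X) -> G P ->
  loc P (ideal_mul total X) 1.
Proof.
move=> fX eqX GP; have pP := primeG GP; have fT := total_fractional.
have fTT : fractional_ideal (ideal_mul total total) by exact: ideal_mul_fractional.
have fTTX := ideal_mul_fractional fTT fX.
have sL : submodule (loc P (ideal_mul total X)).
  by apply: loc_submodule => //; apply: ideal_mul_submodule; exact: fractional_submodule.
have T_TTX : total `<=` loc P (ideal_mul (ideal_mul total total) X).
  by move=> x /(star_extensive hstar fT); rewrite eqX; exact: star_loc.
have [[n bP]|nbP] := pselect (exists n, inside (b n) P).
  (* At [P], [total] is $Q_n$, so $I Q_n$ lies in $I Q_n^2 X$, which [quot_mul] puts in $Q_n X$. *)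
  apply: (loc_mono pP _ (quot_unit (rb n) r00 GP)).
  apply: ideal_mul_sub => // u x Iu Qx.
  have [s ns h] := T_TTX _ (quot_total Qx).
  apply: (loc_denom pP ns); rewrite mulrCA.
  move: (iota s * x) h; apply: ideal_mul3_sub => [|y z w Ty Tz Xw /=].
    exact: preim_mull_submodule.
  have [a na Qy] := total_loc_quot GP bP Ty.
  have [c nc Qz] := total_loc_quot GP bP Tz.
  apply: (loc_denom pP (prime_notM pP na nc)); apply: sub_loc => //.
  have -> : iota (a * c) * (u * (y * z * w)) = (iota a * y) * u * (iota c * z) * w.
    by rewrite tofracM; ring.
  by apply: mem_ideal_mul => //; apply: (@quot_total n); exact: (quot_mul (rb n)).
(* At a prime containing no [b n], 1 lies in $T^2 X$ locally, and the first factor [total] is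
   absorbed by $R_P$. *)
have T1 : total 1 by apply: base_ring_total; exists 1 => //; rewrite tofrac1.
apply: (loc_mono pP _ (T_TTX _ T1)); apply: ideal_mul3_sub => // x y z Tx Ty Xz.
have nbP' n : ~ inside (b n) P by move=> bP; apply: nbP; exists n.
have [s ns [r _ rx]] := total_loc_base GP nbP' Tx.
apply: (loc_denom pP ns); apply: sub_loc => //.
have -> : iota s * (x * y * z) = iota r * y * z by rewrite rx; ring.
by apply: mem_ideal_mul => //; case: fT => _ _ + _ _; apply.
Qed.

Lemma no_comaximal_sequence : False.
Proof.
have fT := total_fractional; have sT := fractional_submodule fT.
have [X fX eqX] := hclifford fT; have sX := fractional_submodule fX.
have fTX := ideal_mul_fractional fT fX.
have : star (ideal_mul total X) 1.
  by apply/star_locP => // P GP; exact: clifford_total_unit.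
rewrite hft // => -[F [[fF [gs FE]] FTX] F1].
have [|n Fn] := @span_mul_total_fin X gs; first by rewrite -FE.
(* The index bounding [F] also selects the prime: at [P] the sum [partial_sum n] is trivial, so the
   unit must come from [X]. *)
have [P GP bP] := proper n; have pP := primeG GP.
have [s ns Xs] : loc P X 1.
  apply: (loc_mono pP _ (star_loc fF GP F1)); rewrite FE.
  apply: subset_trans Fn _; apply: ideal_mul_sub; first exact: loc_submodule.
  move=> x y /(partial_sum_loc_base GP bP)[s ns [r _ rx]] Xy.
  by exists s => //; rewrite mulrA -rx; case: sX => _ _; apply.
rewrite mulr1 in Xs.
(* With [s] in [X] and outside [P], [x * y] times [s] lies in $T^2 X$, hence in [star total], which
   localizes into $(Q_n)_P$. *)
apply: (quot_not_idempotent (rb n) r00 GP bP) => x y Qx Qy.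
apply: (loc_denom pP ns); apply: (loc_mono pP (total_loc_quot GP bP)).
apply: (star_loc fT GP); rewrite eqX; apply: (star_extensive hstar).
  by apply: ideal_mul_fractional => //; exact: ideal_mul_fractional.
rewrite mulrC; apply: mem_ideal_mul => //.
by apply: mem_ideal_mul; [exact: quot_total Qx|exact: quot_total Qy].
Qed.

End ComaximalSequence.

End CliffordRegular.

Theorem theorem5p2 (R : idomainType) (star : set {fraction R} -> set {fraction R})
    (hstar : star_operation star)
    (hspectral : star_spectral star)
    (hfinite_type : star_finite_type star)
    (htilde : forall I : set {fraction R},
       fractional_ideal I -> star I = star_tilde star I)
    (hclifford : clifford_star_regular star) :
  star_finite_character star.
Proof.
move=> r r0; apply: contrapT => inf.
have [G [primeG _ _ starG]] := hspectral.
have [b [rb proper comax]] :=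
  comaximal_sequence hstar hfinite_type primeG starG r0 inf.
exact: (no_comaximal_sequence hstar hfinite_type primeG starG hclifford rb r0).
Qed.
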